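(* Let $k,n\ge 1$ be fixed integers. Suppose that $\xi$ is an integrable random variable on $(\Omega,\mathcal{F},\mathbb{P})$ and that $\mathcal{G}=\{\mathcal{G}_i^j\}_{1\le i\le n,\,1\le j\le k}$ is a family of sub-$\sigma$-algebras of $\mathcal{F}$ such that $\mathcal{G}_1^j\subseteq\mathcal{G}_2^j\subseteq\cdots\subseteq\mathcal{G}_n^j$ for each $j\in\{1,\dots,k\}$ (no relation between $\sigma$-algebras with different $j$ is imposed). Then the maximal function $M_{\mathcal{G}}\xi$ satisfies $$(M_{\mathcal{G}}\xi)^*_{(k)}\le\mathcal{M}_{(k)}(\xi^*_{(k)})\qquad\lambda_k\text{-almost everywhere on }\mathcal{R}_k.$$
   Context: $(\Omega,\mathcal{F},\mathbb{P})$ is an arbitrary nonatomic probability space, and $M_{\mathcal{G}}\xi=\max_{1\le i\le n,\,1\le j\le k}|\mathbb{E}(\xi|\mathcal{G}_i^j)|$. For a positive integer $k$, let $\mathcal{R}_k=\bigcup_{j=1}^k H_j\subset\mathbb{C}$, where $H_j$ is the closed line segment (ray) with endpoints $0$ and $e^{2\pi i j/k}$. $\mathcal{R}_k$ is equipped with the British railway metric: $d(x,y)=|x-y|$ if $x,y$ lie on the same ray $H_j$, and $d(x,y)=|x|+|y|$ otherwise. $\lambda_k$ is the normalized one-dimensional Lebesgue measure on $\mathcal{R}_k$ (so $\lambda_k(\mathcal{R}_k)=1$ and each ray has measure $1/k$). For a random variable $\xi$ on $\Omega$ put $d_\xi(s)=\mathbb{P}(|\xi|>s)$, $s\ge 0$.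 The $k$-decreasing rearrangement $\xi^*_{(k)}$ of $\xi$ is the function on $\mathcal{R}_k$ given by $\xi^*_{(k)}(e^{2\pi i j/k}t)=\inf\{s>0: d_\xi(s)\le t\}$ for $t\in[0,1]$, $j=1,\dots,k$. For an integrable function $f$ on $\mathcal{R}_k$, the uncentered Hardy--Littlewood maximal function is $$\mathcal{M}_{(k)}f(x)=\sup\frac{1}{\lambda_k(B)}\int_B|f|\,d\lambda_k,\qquad x\in\mathcal{R}_k,$$ where the supremum is taken over all open balls $B\subseteq\mathcal{R}_k$ (with respect to the metric $d$) which contain $x$. *)

(* Defs.v *)
From HB Require Import structures.
From mathcomp Require Import all_boot all_order all_algebra.
From mathcomp Require Import all_classical all_reals all_analysis.
From mathcomp Require Import complex lra.

Set Implicit Arguments.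
Unset Strict Implicit.
Unset Printing Implicit Defensive.

Import Order.TTheory GRing.Theory Num.Theory.
Import numFieldNormedType.Exports.
Import Normc.

Local Open Scope classical_set_scope.
Local Open Scope ring_scope.
Local Open Scope complex_scope.

Section railway_set.
Context {R : realType}.
Implicit Types (k j : nat) (t : R) (z w : R[i]).

Definition expi (theta : R) : R[i] := cos theta +i* sin theta.

Definition ray_point k j t : R[i] := t%:C * expi (2 * pi * j%:R / k%:R).

Definition ray k j : set R[i] := [set ray_point k j t | t in `[0, 1]%classic].

(* The point 0 lies on every ray, so adding it only matters for k = 0, where it
   keeps the type built on this set inhabited, as measurable types must be. *)
Definition railway_set k : set R[i] :=
  0 |` \bigcup_(j in [set j | (1 <= j <= k)%N]) ray k j.

Definition same_ray k z w :=
  exists2 j, (1 <= j <= k)%N & ray k j z /\ ray k j w.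

Definition railway_dist k z w : R :=
  if `[< same_ray k z w >] then normc (z - w) else normc z + normc w.

Lemma normc_expi theta : normc (expi theta) = 1.
Proof. by rewrite /= cos2Dsin2 sqrtr1. Qed.

Lemma normc_ray_point k j t : normc (ray_point k j t) = `|t|.
Proof.
rewrite /ray_point normcM normc_expi mulr1 /=.
by rewrite expr0n addr0 sqrtr_sqr.
Qed.

Lemma normc_ray_pointB k j s t :
  normc (ray_point k j s - ray_point k j t) = `|s - t|.
Proof.
rewrite -(@normc_ray_point k j); congr normc.
by rewrite /ray_point -mulrBl -rmorphB.
Qed.

Lemma railway_dist_le k z w : normc (z - w) <= railway_dist k z w.
Proof.
rewrite /railway_dist; case: ifP => // _.
by rewrite (le_trans (le_normcD _ _)) // normcN.
Qed.

Lemma railway_distxx k z : railway_set k z -> railway_dist k z z = 0.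
Proof.
rewrite /railway_dist; case: asboolP => [_ _|nzz]; first by rewrite subrr normc0.
case=> [->|[j jk zj]]; first by rewrite normc0 addr0.
by exfalso; apply: nzz; exists j.
Qed.

Lemma railway_distC k z w : railway_dist k z w = railway_dist k w z.
Proof.
rewrite /railway_dist.
have -> : same_ray k z w = same_ray k w z.
  by rewrite propeqE; split=> -[j jk [? ?]]; exists j.
by case: ifP => _; [rewrite -normcN opprB|rewrite addrC].
Qed.

Lemma railway_dist_eq0 k z w : railway_dist k z w = 0 -> z = w.
Proof.
move=> zw0; apply/eqP; rewrite -subr_eq0; apply/eqP/eq0_normc.
apply/eqP; rewrite eq_le -{1}zw0 railway_dist_le /=.
by case: (z - w) => a b /=; exact: sqrtr_ge0.
Qed.

Lemma ray_common k i j y :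
  ray k i y -> ray k j y -> y != 0 -> ray k i `<=` ray k j.
Proof.
move=> [s /= s01 <-] [t /= t01 e] y0.
have est : s = t.
  have := congr1 (@normc R) e; rewrite !normc_ray_point.
  move: s01 t01; rewrite !in_itv /= => /andP[s0 _] /andP[t0 _].
  by rewrite !ger0_norm.
have s0 : s != 0 by apply: contraNneq y0 => ->; rewrite /ray_point mul0r.
have ee : expi (2 * pi * i%:R / k%:R) = expi (2 * pi * j%:R / k%:R).
  move: e; rewrite -est /ray_point => /(mulfI _) ->//.
  by apply: contra s0 => /eqP[->].
by move=> _ [u u01 <-]; exists u => //; rewrite /ray_point ee.
Qed.

Lemma railway_dist_triangle k y x z :
  railway_dist k x z <= railway_dist k x y + railway_dist k y z.
Proof.
have [xz|nxz] := asboolP (same_ray k x z).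
  rewrite {1}/railway_dist asboolT//.
  rewrite (le_trans _ (lerD (railway_dist_le _ _ _) (railway_dist_le _ _ _)))//.
  by rewrite (le_trans _ (le_normcD _ _))// addrA subrK.
have nD (a b : R[i]) : normc a <= normc b + normc (a - b).
  by rewrite (le_trans _ (le_normcD _ _))// addrC subrK.
have n0 (a : R[i]) : 0 <= normc a by case: a => ? ? /=; exact: sqrtr_ge0.
rewrite /railway_dist (asboolF nxz).
case: asboolP => [xy|nxy]; case: asboolP => [yz|nyz].
- have [y0|y0] := eqVneq y 0.
    by rewrite y0 subr0 sub0r normcN.
  exfalso; case: xy yz => i ik [xi yi] [j jk [yj zj]]; apply: nxz.
  by exists j => //; split => //; exact: (ray_common yi yj y0).
- by rewrite addrA lerD2r addrC nD.
- by rewrite -addrA lerD2l (le_trans (nD z y))// -(normcN (z - y)) opprB.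
- by rewrite addrA lerD2r -addrA lerDl addr_ge0.
Qed.

End railway_set.

Record railway (R : realType) (k : nat) :=
  Railway { rval :> R[i]; _ : rval \in railway_set k }.

Arguments rval {R k}.

HB.instance Definition _ R k := [isSub for @rval R k].
HB.instance Definition _ R k := [Choice of railway R k by <:].

Section railway_space.
Context {R : realType} {k : nat}.
Local Notation rw := (railway R k).

Lemma railwayP (x : rw) : railway_set k (rval x).
Proof. by case: x => z /= /set_mem. Qed.

Let rdist (x y : rw) : R := railway_dist k (rval x) (rval y).

Let rdistxx x : rdist x x = 0.
Proof. exact/railway_distxx/railwayP. Qed.

Let rdist_eq0 x y : rdist x y = 0 -> x = y.
Proof. by move/railway_dist_eq0/val_inj. Qed.

Let rdistC x y : rdist x y = rdist y x.
Proof. exact: railway_distC. Qed.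

Let rdist_triangle y x z : rdist x z <= rdist x y + rdist y z.
Proof. exact: railway_dist_triangle. Qed.

HB.instance Definition _ := @isMetric.Build R rw rdist
  rdistxx rdist_eq0 rdistC rdist_triangle.

Let railway_set0 : (0 : R[i]) \in railway_set k.
Proof. by rewrite inE; left. Qed.

HB.instance Definition _ := isPointed.Build rw (Railway railway_set0).

HB.instance Definition _ :=
  Measurable.copy rw (g_sigma_algebraType (@open rw)).

End railway_space.

Section railway_measure.
Context {R : realType} {k : nat}.
Local Notation rw := (railway R k).
Local Notation leb := (@lebesgue_measure R).

(* The trace of A on the j-th ray, in the arc length parameter. *)
Definition ray_trace (A : set rw) (j : nat) : set R :=
  [set t | t \in `[0, 1] /\ (rval @` A) (ray_point k j t)].

Lemma ray_traceE A j (t : R) (x : rw) : t \in `[0, 1] -> rval x = ray_point k j t ->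
  ray_trace A j t <-> A x.
Proof.
move=> t01 xt; split=> [[_ [y Ay yt]]|Ax]; last by split => //; exists x.
by rewrite (val_inj (etrans xt (esym yt))).
Qed.

Let clamp (t : R) : R := Num.max 0 (Num.min t 1).

Let clamp01 t : clamp t \in `[0, 1].
Proof. by rewrite in_itv /= /clamp le_max lexx ge_max ler01 ge_min lexx orbT. Qed.

Let clamp_id (t : R) : t \in `[0, 1] -> clamp t = t.
Proof.
by rewrite in_itv /= /clamp => /andP[t0 t1]; rewrite min_l// max_r.
Qed.

Let clampB s t : `|clamp s - clamp t| <= `|s - t|.
Proof.
wlog st : s t / s <= t => [wl|].
  by have [/wl//|/ltW/wl] := leP s t; rewrite distrC (distrC s).
rewrite distrC (distrC s) !ger0_norm ?subr_ge0//.
  by rewrite /clamp /Num.max /Num.min; do !case: ifPn; rewrite -?leNgt => *; lra.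
by rewrite /clamp /Num.max /Num.min; do !case: ifPn; rewrite -?leNgt => *; lra.
Qed.

Lemma railway_set_ray_point j (t : R) : (1 <= j <= k)%N -> t \in `[0, 1] ->
  ray_point k j t \in railway_set k.
Proof. by move=> jk t01; rewrite inE; right; exists j => //; exists t. Qed.

Lemma measurable_ray_trace A j : (1 <= j <= k)%N -> measurable A ->
  measurable (ray_trace A j).
Proof.
move=> jk mA; pose g t : rw := Railway (railway_set_ray_point jk (clamp01 t)).
have -> : ray_trace A j = `[0, 1]%classic `&` g @^-1` A.
  apply/seteqP; split=> t.
  - move=> tA; have [t01 _] := tA; split => //.
    by apply/(@ray_traceE A j t) => //=; rewrite clamp_id.
  - by move=> [t01 Agt]; apply/(@ray_traceE A j t (g t)) => //=; rewrite clamp_id.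
apply: measurableI => //.
suff mg : measurable_fun setT g by rewrite -[X in measurable X]setTI; exact: mg.
apply: (@measurability _ _ _ _ setT g (@open rw)) => //.
move=> _ [U oU <-]; rewrite setTI; apply: measurable_realfun.open_measurable.
apply: open_comp => // t _.
apply/(@metricType_numDomainType.cvgrPdist_lt _ rw) => e e0.
have tj u : ray k j (rval (g u)) by exists (clamp u) => //; exact: clamp01.
near=> u; rewrite [mdist _ _]/(railway_dist k _ _) /railway_dist.
rewrite asboolT; last by exists j.
rewrite normc_ray_pointB (le_lt_trans (clampB _ _))//.
Unshelve. all: by end_near. Qed.

Local Open Scope ereal_scope.

Definition railway_measure (A : set rw) : \bar R :=
  (k%:R^-1)%R%:E * \sum_(j < k) leb (ray_trace A j.+1).

Let railway_measure0 : railway_measure set0 = 0.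
Proof.
rewrite /railway_measure big1 ?mule0// => j _.
rewrite (_ : ray_trace _ _ = set0) ?measure0//.
by rewrite -subset0 => t [_ []].
Qed.

Let railway_measure_ge0 A : 0 <= railway_measure A.
Proof. by rewrite /railway_measure mule_ge0 ?lee_fin ?invr_ge0 ?sume_ge0. Qed.

Let railway_measure_sigma_additive : semi_sigma_additive railway_measure.
Proof.
move=> F mF tF mUF; rewrite [X in _ --> X](_ : _ =
    lim ((fun n => \sum_(0 <= i < n) railway_measure (F i)) @ \oo)).
  by apply: is_cvg_ereal_nneg_natsum => n _; exact: railway_measure_ge0.
rewrite nneseriesZl; last by move=> n _; rewrite sume_ge0.
congr (_ * _); rewrite nneseries_sum//; apply: eq_bigr => j _.
have jk : (j.+1 <= k)%N by exact: ltn_ord.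
rewrite -measure_semi_bigcup.
- congr (leb _); apply/seteqP; split=> t.
    by move=> [t01 [x [n _ Fx] xt]]; exists n => //; split => //; exists x.
  by move=> [n _ [t01 [x Fx xt]]]; split => //; exists x => //; exists n.
- by move=> n; exact: measurable_ray_trace.
- apply/trivIsetP => m n _ _ mn; rewrite -subset0 => t [[t01 [x Fx xt]]].
  move=> /(ray_traceE _ t01 xt) Fnx.
  have /trivIsetP/(_ m n Logic.I Logic.I mn) := tF.
  by rewrite -subset0 => /(_ x); exact.
- rewrite (_ : \bigcup_i _ = ray_trace (\bigcup_i F i) j.+1); last first.
    apply/seteqP; split=> t.
      by move=> [n _ [t01 [x Fx xt]]]; split => //; exists x => //; exists n.
    by move=> [t01 [x [n _ Fx] xt]]; exists n => //; split => //; exists x.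
  exact: measurable_ray_trace.
Qed.

HB.instance Definition _ := isMeasure.Build _ _ _ railway_measure
  railway_measure0 railway_measure_ge0 railway_measure_sigma_additive.

Lemma railway_measureT : (0 < k)%N -> railway_measure setT = 1.
Proof.
move=> k0; rewrite /railway_measure (eq_bigr (fun=> 1)) => [|j _].
  by rewrite sumEFin sumr_const card_ord -EFinM mulVf// pnatr_eq0 -lt0n.
rewrite (_ : ray_trace _ _ = `[0%R, 1%R]%classic).
  by rewrite lebesgue_measure_itv/= lte01 oppr0 adde0.
apply/seteqP; split=> [t [] //|t t01]; split => //.
by exists (Railway (@railway_set_ray_point j.+1 t (ltn_ord j) t01)).
Qed.

End railway_measure.
Arguments railway_measure R k A : clear implicits.

Section railway_maximal.
Context {R : realType} {k : nat}.
Local Open Scope ereal_scope.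

Definition railway_maximal (f : railway R k -> \bar R) (x : railway R k) :
    \bar R :=
  ereal_sup [set (railway_measure R k B)^-1 *
                 \int[railway_measure R k]_(y in B) `|f y|
    | B in [set B | B x /\ exists c r, (0 < r)%R /\ B = ball c r]].

End railway_maximal.

Section random_variables.
Context {d} {T : measurableType d} {R : realType}.
Variable P : probability T R.
Local Open Scope ereal_scope.

Definition nonatomic :=
  forall A, measurable A -> 0 < P A ->
    exists B, [/\ measurable B, B `<=` A, 0 < P B & P B < P A].

Definition upper_tail (X : T -> R) (s : R) : \bar R := P [set w | (s < `|X w|)%R].

(* On the point e^(2 pi i j / k) t of the j-th ray the modulus is t, see
   rearrangement_ray_point.  The infimum is +oo at x = 0 when X is essentially
   unbounded. *)
Definition rearrangement k (X : T -> R) (x : railway R k) : \bar R :=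
  ereal_inf [set s%:E |
    s in [set s | (0 < s)%R /\ upper_tail X s <= (normc (rval x))%:E]].

Lemma rearrangement_ray_point k (X : T -> R) (x : railway R k) j t :
  t \in `[0%R, 1%R] -> rval x = ray_point k j t ->
  rearrangement X x =
  ereal_inf [set s%:E | s in [set s | (0 < s)%R /\ upper_tail X s <= t%:E]].
Proof.
rewrite in_itv /= => /andP[t0 _] xt.
by rewrite /rearrangement xt normc_ray_point ger0_norm.
Qed.

Definition is_sub_sigma_algebra (G : set (set T)) :=
  sigma_algebra setT G /\ G `<=` measurable.

(* Y is a version of the conditional expectation E(X | G). *)
Definition is_cond_exp (G : set (set T)) (X Y : T -> R) :=
  [/\ forall B : set R, measurable B -> G (Y @^-1` B),
      P.-integrable setT (EFin \o Y) &
      forall A, G A -> \int[P]_(w in A) (Y w)%:E = \int[P]_(w in A) (X w)%:E].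

End random_variables.

(* The values are nonnegative, so the unit 0 of the iterated maximum is
   harmless. *)
Definition max_abs (T : Type) (R : realType) n k (Y : 'I_n -> 'I_k -> T -> R)
    (w : T) : R :=
  \big[Num.max/0]_(i < n) \big[Num.max/0]_(j < k) `|Y i j w|.

(* Main.v *)
Require Import Defs.
From HB Require Import structures.
From mathcomp Require Import all_boot all_order all_algebra.
From mathcomp Require Import all_classical all_reals all_analysis.
From mathcomp Require Import measurable_realfun complex.
From mathcomp Require Import lra ring.

Set Implicit Arguments.
Unset Strict Implicit.
Unset Printing Implicit Defensive.

Import Order.TTheory GRing.Theory Num.Theory.
Import numFieldNormedType.Exports.

Local Open Scope classical_set_scope.
Local Open Scope ring_scope.
Local Open Scope ereal_scope.

(** Write f for the decreasing rearrangement of xi, so that f > r exactly on the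
    part of the railway at distance less than P(|xi| > r) from the centre, and
    let M be the maximal function.  Fix a point x at distance t > 0 from the
    centre and a level s > 0 below the rearrangement of M at x, which means
    P(M > s) > t.  It suffices to find a ball containing x on which the average
    of f is at least s.

    For each j let A_j be the event that the j-th filtration produces a
    conditional expectation of modulus above s.  Doob's maximal inequality
    (doob_maximal_inequality) says that h = |xi| - s has a nonnegative integral
    over every A_j.  The k families are unrelated, so nothing can be said about
    how the A_j overlap.  The device replacing such information is to add
    B = {|xi| > s} = {h > 0}, to put C = B u A_1 u ... u A_k, and to integrate
    the pointwise inequality

      sum_j h 1_{A_j} <= h 1_C + (k - 1) h 1_B,

    which holds because at a point where h > 0 the left side is at most k h,
    while at a point of C where h <= 0 it contains at least one h.  Hence
    (union_integral_ge0, maximal_level_integral)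

      s (P(C) + (k - 1) P(B)) <= E(|xi|; C) + (k - 1) E(|xi|; B).

    The right combination of one C and k - 1 copies of B is precisely what a
    ball of the railway looks like: with u = P(C) and v = P(B), the ball of
    radius (u + v)/2 centred at distance (u - v)/2 on the ray of x meets that
    ray in (-v, u), cut at the centre, and each other ray in [0, v)
    (skew_ball).  It contains x because u >= P(M > s) > t.  Its measure is
    (u + (k - 1) v)/k, and the Hardy-Littlewood inequality on each ray
    (rearrangement_integral_ge) bounds the integral of f over it from below by
    (E(|xi|; C) + (k - 1) E(|xi|; B))/k.  So the average of f is at least s.

    The Hardy-Littlewood inequality is obtained by writing the integrals on both
    spaces as integrals of measures of superlevel sets (layer_cake): for every
    r, the event D n {|xi| > r} has probability at most
    min (P(D), P(|xi| > r)), and this is the length, on a ray, of the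
    intersection of [0, P(D)) with {f > r}. *)

(** * The layer cake formula *)

(** Tonelli for the indicator of the region 0 <= r < f x over D. *)
Lemma layer_cake d (T : measurableType d) (R : realType)
    (mu : {sigma_finite_measure set T -> \bar R}) (D : set T)
    (f : T -> \bar R) :
  measurable D -> measurable_fun setT f -> (forall x, 0 <= f x) ->
  \int[mu]_(x in D) f x =
  \int[lebesgue_measure]_(r in `[0%R, +oo[) mu (D `&` [set x | r%:E < f x]).
Proof.
move=> mD mf f0.
pose Z := (D `*` `[0%R, +oo[%classic) `&`
  [set z : T * R | z.2%:E < f z.1].
have mZ : measurable Z.
  apply: measurableI; first exact: measurableX.
  rewrite -[X in measurable X]setTI; apply: measurable_lte => //.
    by apply/measurable_EFinP; exact: measurable_snd.
  exact: measurableT_comp mf measurable_fst.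
have mI : measurable_fun setT (fun z => (\1_Z z)%:E : \bar R).
  by apply/measurable_EFinP; exact: measurable_indic.
have rmZ r : measurable [set x | Z (x, r)].
  rewrite [X in measurable X](_ : _ = ysection Z r); last exact/esym/ysectionE.
  exact: measurable_ysection.
have lmZ x : measurable [set r | Z (x, r)].
  rewrite [X in measurable X](_ : _ = xsection Z x); last exact/esym/xsectionE.
  exact: measurable_xsection.
have yI r : \int[mu]_x (\1_Z (x, r))%:E = mu [set x | Z (x, r)].
  rewrite -(setIT [set x | Z (x, r)]).
  exact: (integral_indic _ measurableT (rmZ r)).
have xI x : \int[lebesgue_measure]_r (\1_Z (x, r))%:E =
    lebesgue_measure [set r | Z (x, r)].
  rewrite -(setIT [set r | Z (x, r)]).
  exact: (integral_indic (@lebesgue_measure R) measurableT (lmZ x)).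
transitivity (\int[mu]_x \int[lebesgue_measure]_r (\1_Z (x, r))%:E).
  rewrite integral_mkcond; apply: eq_integral => x _; rewrite xI patchE.
  case: ifPn => [/set_mem Dx|/negP xD]; last first.
    rewrite (_ : [set r | _] = set0) ?measure0// -subset0 => r [[/= Dx _] _].
    by apply: xD; exact/mem_set.
  rewrite (_ : [set r | _] = [set r | 0 <= r%:E < f x]); last first.
    apply/seteqP; split => r /=.
      by move=> [[_ /=]]; rewrite in_itv /= andbT -lee_fin => -> /= ->.
    by case/andP; rewrite lee_fin => r0 rf; split=> //; split => //=;
      rewrite in_itv /= r0.
  have := f0 x; case: (f x) => [a|_|//].
    rewrite lee_fin => a0; rewrite (_ : [set r | _] = `[0%R, a[%classic).
      rewrite lebesgue_measure_itv /= lte_fin.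
      by case: ltgtP a0 => // [_ _|<- _]; rewrite ?oppr0 ?adde0.
    by apply/seteqP; split => r /=; rewrite in_itv /= lee_fin lte_fin.
  rewrite (_ : [set r | _] = `[0%R, +oo[%classic).
    by rewrite lebesgue_measure_itv /= ltry.
  by apply/seteqP; split => r /=; rewrite in_itv /= lee_fin ltry.
rewrite (@fubini_tonelli _ _ _ _ _ mu lebesgue_measure
  (fun z => (\1_Z z)%:E))//=.
rewrite [RHS]integral_mkcond; apply: eq_integral => r _; rewrite yI patchE.
case: ifPn => [/set_mem r0|/negP r0].
  by congr (mu _); apply/seteqP; split => x /=; [case=> [[]]|case].
rewrite (_ : [set x | _] = set0) ?measure0// -subset0 => x [[/= _ rr] _].
by apply: r0; exact/mem_set.
Qed.

Lemma measurable_tail_measure d (T : measurableType d) (R : realType)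
    (mu : {sigma_finite_measure set T -> \bar R}) (D : set T)
    (f : T -> \bar R) :
  measurable D -> measurable_fun setT f ->
  measurable_fun setT (fun r : R => mu (D `&` [set x | r%:E < f x])).
Proof.
move=> mD mf; pose Z := (D `*` setT) `&` [set z : T * R | z.2%:E < f z.1].
have mZ : measurable Z.
  apply: measurableI; first exact: measurableX.
  rewrite -[X in measurable X]setTI; apply: measurable_lte => //.
    by apply/measurable_EFinP; exact: measurable_snd.
  exact: measurableT_comp mf measurable_fst.
rewrite (_ : (fun r => _) = mu \o ysection Z).
  exact: measurable_fun_ysection.
apply/funext => r /=; rewrite ysectionE; congr (mu _).
by apply/seteqP; split => x /=; [case=> ? ?; split|case=> -[? _] ?; split].
Qed.

(** * Doob's maximal inequality *)

Lemma measurable_abs_EFin d (T : measurableType d) (R : realType) (X : T -> R)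
    (D : set T) :
  measurable_fun setT X -> measurable_fun D (fun w => `|X w|%:E).
Proof.
move=> mX; apply/measurable_EFinP/measurableT_comp => //.
exact: measurable_funTS.
Qed.

Lemma integrable_measurable d (T : measurableType d) (R : realType)
    (mu : {measure set T -> \bar R}) (X : T -> R) :
  mu.-integrable setT (EFin \o X) -> measurable_fun setT X.
Proof. by move=> /measurable_int /measurable_EFinP. Qed.

(** On a set A of G, the sign of Y cuts A into two pieces of G, on each of which
    the integral of |Y| is, up to sign, that of Y, hence that of X. *)
Lemma cond_exp_abs_le d (T : measurableType d) (R : realType)
    (P : probability T R) (G : set (set T)) (X Y : T -> R) (A : set T) :
  is_sub_sigma_algebra G -> P.-integrable setT (EFin \o X) ->
  is_cond_exp P G X Y -> G A ->
  \int[P]_(w in A) `|Y w|%:E <= \int[P]_(w in A) `|X w|%:E.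
Proof.
move=> [sG Gm] iX [YG iY eXY] GA.
have GI B C : G B -> G C -> G (B `&` C).
  by rewrite -(measurable_g_measurableTypeE sG); exact: measurableI.
have mX := integrable_measurable iX.
have mXA B := measurable_abs_EFin (D := B) mX.
have mYA B := measurable_abs_EFin (D := B) (integrable_measurable iY).
pose A1 := A `&` Y @^-1` `[0%R, +oo[; pose A2 := A `&` Y @^-1` `]-oo, 0%R[.
have GA1 : G A1 by apply: GI => //; exact: YG.
have GA2 : G A2 by apply: GI => //; exact: YG.
have A12 : A = A1 `|` A2.
  rewrite /A1 /A2 -setIUr -preimage_setU (_ : _ `|` _ = setT) ?setIT//.
  apply/seteqP; split => // r _ /=; rewrite !in_itv /= andbT.
  by case: (leP 0%R r) => ?; [left|right].
have dA12 : [disjoint A1 & A2].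
  rewrite disj_set2E; apply/eqP; rewrite -subset0 => w [[_ /=] + [_ /=]].
  by rewrite !in_itv /= andbT leNgt => /negP.
have absle B : measurable B -> `| \int[P]_(w in B) (X w)%:E | <=
    \int[P]_(w in B) `|X w|%:E.
  move=> mB; apply: le_abse_integral => //.
  exact/measurable_EFinP/measurable_funTS.
rewrite A12 !ge0_integral_setU//; do ?exact: Gm.
apply: leeD.
- rewrite (eq_integral (fun w => (Y w)%:E)) => [|w].
    by rewrite eXY// (le_trans (lee_abs _)) ?absle//; exact: Gm.
  by rewrite inE => -[_ /=]; rewrite in_itv /= andbT => /ger0_norm ->.
- rewrite (eq_integral (fun w => - (Y w)%:E)) => [|w].
    rewrite integralN/=; last first.
      apply: integrable_add_def; first exact: Gm.
      by apply: (integrableS measurableT _ _ iY) => //; exact: Gm.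
    by rewrite eXY// (le_trans (lee_abs _))// abseN absle//; exact: Gm.
  by rewrite inE => -[_ /=]; rewrite in_itv /= => /ltr0_norm ->.
Qed.

(** Doob's weak type inequality for a finite filtration.  The set V i below is
    the event that i is the first index at which |Y i| exceeds s.  It belongs to
    G i, so the integral of |Y i| over it is at most that of |X|. *)
Lemma doob_maximal_inequality d (T : measurableType d) (R : realType)
    (P : probability T R) (n : nat) (G : 'I_n -> set (set T))
    (X : T -> R) (Y : 'I_n -> T -> R) (s : R) :
  P.-integrable setT (EFin \o X) ->
  (forall i, is_sub_sigma_algebra (G i)) ->
  (forall i1 i2 : 'I_n, (i1 <= i2)%N -> G i1 `<=` G i2) ->
  (forall i, is_cond_exp P (G i) X (Y i)) -> (0 <= s)%R ->
  s%:E * P [set w | exists i, (s < `|Y i w|)%R] <=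
  \int[P]_(w in [set w | exists i, (s < `|Y i w|)%R]) `|X w|%:E.
Proof.
move=> iX sG incG ceY s0; set A := [set w | _].
have mX D := measurable_abs_EFin (D := D) (integrable_measurable iX).
have mY i D : measurable_fun D (fun w => `|Y i w|%:E).
  by have [_ /integrable_measurable iY _] := ceY i; exact: measurable_abs_EFin.
pose U i := [set w | (s < `|Y i w|)%R].
have UG i : G i (U i).
  have [YG _ _] := ceY i.
  have -> : U i = Y i @^-1` [set r | (s < `|r|)%R] by [].
  apply: YG.
  rewrite [X in measurable X](_ : _ = Num.norm @^-1` `]s, +oo[%classic).
    rewrite -[X in measurable X]setTI.
    exact: normr_measurable measurableT _ (measurable_itv _).
  by apply/seteqP; split => r /=; rewrite in_itv /= andbT.
pose V i := U i `&` \bigcap_(l in [set l : 'I_n | (l < i)%N]) ~` U l.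
have VG i : G i (V i).
  have [/measurable_g_measurableTypeE <- _] := sG i.
  apply: measurableI.
    by rewrite measurable_g_measurableTypeE//; case: (sG i).
  apply: fin_bigcap_measurable => // l /= li; apply: measurableC.
  rewrite measurable_g_measurableTypeE; last by case: (sG i).
  by apply: (incG l); [exact: ltnW|exact: UG].
have mV i : measurable (V i) by have [_] := sG i; exact.
have AV : A = \big[setU/set0]_(i <- enum 'I_n) V i.
  rewrite -bigcup_seq; apply/seteqP; split => w /=.
    move=> [i0 i0w].
    case: (@arg_minnP _ i0 (fun i => s < `|Y i w|)%R (@nat_of_ord n) i0w).
    move=> i iw imin.
    exists i; first by rewrite /= mem_enum.
    by split => // l /= li /imin; rewrite leqNgt li.
  by move=> [i _ [iw _]]; exists i.
have tV : trivIset [set` enum 'I_n] V.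
  suff VV (i l : 'I_n) w : V i w -> V l w -> (i <= l)%N.
    move=> i l _ _ [w [iw lw]]; apply/val_inj/eqP.
    by rewrite eqn_leq !(VV _ _ w).
  by move=> [_ iw] [lw _]; rewrite leqNgt; apply/negP => li; exact: (iw l).
have mA : measurable A by rewrite AV; exact: bigsetU_measurable.
rewrite -integral_cst// AV.
rewrite !ge0_integral_bigsetU ?enum_uniq//.
apply: lee_sum => i _; apply: (@le_trans _ _ (\int[P]_(w in V i) `|Y i w|%:E)).
  apply: ge0_le_integral => //.
  by move=> w [iw _]; rewrite lee_fin ltW.
exact: (cond_exp_abs_le (sG i) iX (ceY i)).
Qed.

(** * Several unrelated filtrations *)

(** The pointwise inequality
    sum_j h 1_{A_j} <= h 1_C + (k - 1) h 1_B, where B = {h > 0} and C is the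
    union of B and of the A_j, integrated.  Adding B to the union keeps the
    whole positive part of h, which makes the overlaps of the A_j harmless. *)
Lemma union_integral_ge0 d (T : measurableType d) (R : realType)
    (mu : {measure set T -> \bar R}) (h : T -> R) (k : nat)
    (A : 'I_k -> set T) :
  mu.-integrable setT (EFin \o h) ->
  (forall j, measurable (A j)) ->
  (forall j, 0 <= \int[mu]_(w in A j) (h w)%:E) ->
  0 <= \int[mu]_(w in [set w | (0 < h w)%R] `|` \bigcup_j A j) (h w)%:E +
       k.-1%:R%:E * \int[mu]_(w in [set w | (0 < h w)%R]) (h w)%:E.
Proof.
move=> ih mA hA; set B := [set w | _]; set C := B `|` _.
have mB : measurable B.
  rewrite /B [X in measurable X](_ : _ = h @^-1` `]0%R, +oo[); last first.
    by apply/seteqP; split => w /=; rewrite in_itv /= andbT.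
  by rewrite -[X in measurable X]setTI; apply: (integrable_measurable ih).
have mC : measurable C.
  by apply: measurableU => //; apply: fin_bigcup_measurable.
have ir D : measurable D -> mu.-integrable setT ((EFin \o h) \_ D).
  by move=> mD; apply/(integrable_mkcond _ mD); exact: integrableS ih.
have iA j := ir _ (mA j).
apply: (@le_trans _ _ (\sum_(j < k) \int[mu]_(w in A j) (h w)%:E)).
  by apply: sume_ge0.
under eq_bigr do rewrite integral_mkcond.
rewrite -integral_sum// (integral_mkcond C) (integral_mkcond B).
rewrite -integralZl//; last exact: ir.
rewrite -integralD//; [|exact: ir|by apply: integrableZl => //; exact: ir].
apply: le_integral => //.
- by apply: integrable_sum.
- by apply: integrableD => //; [exact: ir|apply: integrableZl => //; exact: ir].
move=> w _ /=.
have pE D : ((EFin \o h) \_ D) w = (if w \in D then h w else 0%R)%:E.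
  by rewrite patchE; case: ifP.
rewrite !pE; under eq_bigr do rewrite pE.
rewrite sumEFin -EFinM -EFinD lee_fin.
have [h0|h0] := ltP 0%R (h w).
  (* On B both terms on the right are present and there are k times h. *)
  rewrite !mem_set//=; last by left.
  apply: (@le_trans _ _ (\sum_(j < k) h w)%R).
    by apply: ler_sum => j _; case: ifP => // _; exact: ltW.
  rewrite sumr_const card_ord -[leLHS]mulr_natl.
  have -> : (h w + k.-1%:R * h w = (1 + k.-1%:R) * h w)%R.
    by rewrite mulrDl mul1r.
  rewrite ler_pM2r//.
  by case: (k) => [|m]; rewrite ?addr0// -natr1 addrC.
have -> : (w \in B) = false.
  by apply/negbTE/negP => /set_mem; rewrite /B /= ltNge h0.
rewrite mulr0 addr0; case: ifPn => [/set_mem[]|wC].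
- by rewrite /B /= ltNge h0.
- (* Off B every term is nonpositive and that of one j is already h. *)
  move=> [j _ wAj]; rewrite (bigD1 j)//= mem_set// gerDl.
  by apply: sumr_le0 => l _; case: ifP.
- rewrite big1// => j _; case: ifP => // /set_mem wAj.
  by case/negP: wC; apply/mem_set; right; exists j.
Qed.

Lemma measurable_level d (T : measurableType d) (R : realType) (X : T -> R)
    (s : R) :
  measurable_fun setT X -> measurable [set w | (s < `|X w|)%R].
Proof.
move=> mX.
rewrite [X in measurable X](_ : _ = (fun w => `|X w|)%R @^-1` `]s, +oo[).
  by rewrite -[X in measurable X]setTI; apply: measurableT_comp.
by apply/seteqP; split => w /=; rewrite in_itv /= andbT.
Qed.

Lemma measurable_exists_level d (T : measurableType d) (R : realType) (n : nat)
    (Y : 'I_n -> T -> R) (s : R) :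
  (forall i, measurable_fun setT (Y i)) ->
  measurable [set w | exists i, (s < `|Y i w|)%R].
Proof.
move=> mY.
rewrite (_ : [set w | _] = \bigcup_i [set w | (s < `|Y i w|)%R]).
  apply: fin_bigcup_measurable => // i _.
  exact: measurable_level.
by apply/seteqP; split => [w [ i ]|w [i _]]; exists i.
Qed.

(** The previous inequality for h = |xi| - s, with Doob's inequality giving
    the nonnegativity of the integral of h over the event of each filtration. *)
Lemma maximal_level_integral d (T : measurableType d) (R : realType)
    (P : probability T R) (k n : nat) (xi : T -> R)
    (G : 'I_n -> 'I_k -> set (set T)) (E : 'I_n -> 'I_k -> T -> R) (s : R)
    (B := [set w | (s < `|xi w|)%R])
    (C := B `|` \bigcup_j [set w | exists i, (s < `|E i j w|)%R]) :
  P.-integrable setT (EFin \o xi) ->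
  (forall i j, is_sub_sigma_algebra (G i j)) ->
  (forall (j : 'I_k) (i1 i2 : 'I_n), (i1 <= i2)%N -> G i1 j `<=` G i2 j) ->
  (forall i j, is_cond_exp P (G i j) xi (E i j)) -> (0 <= s)%R ->
  s%:E * (P C + k.-1%:R%:E * P B) <=
   \int[P]_(w in C) `|xi w|%:E + k.-1%:R%:E * \int[P]_(w in B) `|xi w|%:E.
Proof.
move=> ixi sG incG ceE s0.
have mxi := integrable_measurable ixi.
pose A (j : 'I_k) := [set w | exists i, (s < `|E i j w|)%R].
have mA j : measurable (A j).
  apply: measurable_exists_level => i.
  by have [_ /integrable_measurable] := ceE i j.
have mB : measurable B by exact: measurable_level.
have mC : measurable C.
  apply: measurableU => //; apply: fin_bigcup_measurable => // j _.
  exact: mA.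
have iabs D : measurable D -> P.-integrable D (EFin \o (fun w => `|xi w|%R)).
  move=> mD; apply: (integrableS measurableT) => //.
  exact: (integrable_abse ixi).
pose h w := (`|xi w| - s)%R.
have ih : P.-integrable setT (EFin \o h).
  rewrite (_ : _ \o _ = (EFin \o (fun w => `|xi w|%R)) \- (EFin \o cst s)).
    apply: integrableB => //; first exact: iabs.
    exact: finite_measure_integrable_cst.
  by apply/funext => w /=; rewrite EFinB.
have hE D : measurable D -> \int[P]_(w in D) (h w)%:E =
    \int[P]_(w in D) `|xi w|%:E - s%:E * P D.
  move=> mD; rewrite -(integral_cst _ mD) -integralB_EFin//; first exact: iabs.
  exact: finite_measure_integrable_cst.
have Ifin D : measurable D -> (\int[P]_(w in D) `|xi w|%:E \is a fin_num).
  by move=> mD; apply: integrable_fin_num => //; exact: iabs.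
have Pfin D : measurable D -> P D \is a fin_num.
  by move=> mD; exact: fin_num_measure.
have hA j : 0 <= \int[P]_(w in A j) (h w)%:E.
  rewrite hE// sube_ge0; last by rewrite fin_numM// Pfin.
  apply: (@doob_maximal_inequality _ _ _ _ _ (G ^~ j)) => // i1 i2.
  exact: incG.
have := union_integral_ge0 ih mA hA.
have -> : [set w | (0 < h w)%R] = B.
  by apply/seteqP; split => w /=; rewrite subr_gt0.
rewrite -/C !hE//.
rewrite -(fineK (Ifin _ mB)) -(fineK (Ifin _ mC)) -(fineK (Pfin _ mB)).
rewrite -(fineK (Pfin _ mC)) -!(EFinM, EFinB, EFinD) !lee_fin.
by lra.
Qed.

Lemma measurable_bigmaxr (R : realType) d (T : measurableType d) (I : Type)
    (s : seq I) (f : I -> T -> R) :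
  (forall i, measurable_fun setT (f i)) ->
  measurable_fun setT (fun w => \big[Num.max/0%R]_(i <- s) f i w).
Proof.
move=> mf; elim: s => [|i s ih].
  by under eq_fun do rewrite big_nil; exact: measurable_cst.
under eq_fun do rewrite big_cons.
by apply: measurable_maxr => //; exact: mf.
Qed.

Lemma max_abs_gt (T : Type) (R : realType) (n k : nat)
    (Y : 'I_n -> 'I_k -> T -> R) (s : R) (w : T) : (0 <= s)%R ->
  (s < `|max_abs Y w|)%R -> exists j i, (s < `|Y i j w|)%R.
Proof.
move=> s0; rewrite ger0_norm; last exact: bigmax_ge_id.
apply: contraPP => nY; apply/negP; rewrite -leNgt.
apply: bigmax_le => // i _; apply: bigmax_le => // j _; rewrite leNgt.
by apply/negP => sY; apply: nY; exists j, i.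
Qed.

(** * Geometry of the railway *)

Section railway_geometry.
Context {R : realType} {k : nat}.
Implicit Types (i j : nat) (t u : R).

(** If two angles 2 pi i / k < 2 pi j / k had the same direction, their half
    difference phi, which lies strictly between 0 and pi, would satisfy
    cos (2 phi) = 1, that is sin phi = 0. *)
Lemma expi_railway_inj i j : (1 <= i <= k)%N -> (1 <= j <= k)%N ->
  expi (2 * pi * i%:R / k%:R) = expi (2 * pi * j%:R / k%:R) :> R[i] -> i = j.
Proof.
wlog ij : i j / (i < j)%N => [wl ik jk e|].
  have [ij|ji|//] := ltngtP i j; first exact: wl.
  by apply/esym/wl.
move=> /andP[i1 ik] /andP[j1 jk] [ec es]; exfalso.
pose phi : R := (pi * (j - i)%N%:R / k%:R)%R.
have k0 : (0 < k%:R :> R)%R by rewrite ltr0n (leq_trans j1).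
have : (0 < sin phi)%R.
  apply: sin_gt0_pi; apply/andP; split.
    by rewrite divr_gt0// mulr_gt0 ?pi_gt0// ltr0n subn_gt0.
  rewrite ltr_pdivrMr// ltr_pM2l ?pi_gt0// ltr_nat.
  by rewrite (leq_trans _ jk)// ltn_subrL i1.
apply/negP; rewrite -leNgt.
have : (cos (phi + phi) = 1)%R.
  rewrite (_ : phi + phi = 2 * pi * j%:R / k%:R - 2 * pi * i%:R / k%:R)%R.
    by rewrite cosB -ec -es -!expr2 cos2Dsin2.
  rewrite /phi natrB; last exact: ltnW.
  by move: (pi : R) (j%:R : R)%R (i%:R : R)%R (k%:R : R)%R => p a b c; ring.
rewrite cosD -!expr2; have := cos2Dsin2 phi => e1 e2.
have : (sin phi ^+ 2 = 0)%R by lra.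
by move=> /eqP; rewrite sqrf_eq0 => /eqP ->.
Qed.

Lemma ray_point_inj i j (s t : R) :
  (1 <= i <= k)%N -> (1 <= j <= k)%N ->
  s \in `[0%R, 1%R] -> t \in `[0%R, 1%R] ->
  ray_point k i s = ray_point k j t -> s = t /\ (s != 0%R -> i = j).
Proof.
move=> ik jk; rewrite !in_itv /= => /andP[s0 _] /andP[t0 _] e.
have st : s = t.
  by have := congr1 (@Normc.normc R) e; rewrite !normc_ray_point !ger0_norm.
split => // sn0; move: e; rewrite -st /ray_point => /(mulfI _) e.
apply: expi_railway_inj => //; apply: e.
by apply: contra sn0 => /eqP[->].
Qed.

Lemma ray_other_eq0 i j t : (1 <= i <= k)%N -> (1 <= j <= k)%N -> i != j ->
  t \in `[0%R, 1%R] -> ray k j (ray_point k i t) -> t = 0%R.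
Proof.
move=> ik jk ij t01 [s s01 /= e].
have [st] := ray_point_inj jk ik s01 t01 e.
by case: (eqVneq s 0%R) => [<- //|_ /(_ isT) eij]; rewrite eij eqxx in ij.
Qed.

Lemma normc_ge0 (z : R[i]) : (0 <= Normc.normc z)%R.
Proof. by case: z => a b; exact: sqrtr_ge0. Qed.

Lemma railway_dist_ray j t u : (1 <= j <= k)%N ->
  t \in `[0%R, 1%R] -> u \in `[0%R, 1%R] ->
  railway_dist k (ray_point k j t) (ray_point k j u) = `|t - u|%R.
Proof.
move=> jk t01 u01; rewrite /railway_dist asboolT ?normc_ray_pointB//.
by exists j => //; split; [exists t|exists u].
Qed.

Lemma railway_dist_ne i j t u : (1 <= i <= k)%N -> (1 <= j <= k)%N -> i != j ->
  t \in `[0%R, 1%R] -> u \in `[0%R, 1%R] ->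
  railway_dist k (ray_point k i t) (ray_point k j u) = (t + u)%R.
Proof.
move=> ik jk ij t01 u01.
have [t0 u0] : (0 <= t)%R /\ (0 <= u)%R.
  by move: t01 u01; rewrite !in_itv /= => /andP[-> _] /andP[-> _].
rewrite /railway_dist; case: asboolP => [[l lk [il jl]]|_]; last first.
  by rewrite !normc_ray_point !ger0_norm.
have : (t = 0 \/ u = 0)%R.
  have [il'|] := eqVneq i l; last by left; exact: (@ray_other_eq0 i l t).
  by right; apply: (@ray_other_eq0 j l u) => //; rewrite -il' eq_sym.
case=> [t_0|u_0].
  rewrite t_0 {1}/ray_point mul0r sub0r normcN normc_ray_point.
  by rewrite ger0_norm ?add0r.
rewrite u_0 {2}/ray_point mul0r subr0 normc_ray_point.
by rewrite ger0_norm ?addr0.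
Qed.

End railway_geometry.

Section railway_balls.
Context {R : realType} {k : nat}.
Implicit Types (r : R) (x c : railway R k).

Definition railway0 : railway R k := point.

Lemma ball_railwayE c r x :
  ball c r x = (railway_dist k (rval c) (rval x) < r)%R :> Prop.
Proof. by []. Qed.

Lemma railway_dist0 (z : R[i]) : railway_dist k 0%R z = Normc.normc z.
Proof.
rewrite /railway_dist sub0r normcN.
by case: ifP => // _; rewrite Normc.normc0 add0r.
Qed.

Lemma ball_railway0 r :
  ball railway0 r = [set x | (Normc.normc (rval x) < r)%R].
Proof.
by apply/seteqP; split => x /=; rewrite ball_railwayE railway_dist0.
Qed.

Lemma measurable_railway_ball c r : measurable (ball c r).
Proof.
apply: sub_sigma_algebra.
rewrite openE => x xr.
apply/nbhs_ballP; exists (r - mdist c x)%R => /=.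
  by rewrite subr_gt0.
move=> y xy; apply: (le_lt_trans (metric_triangle c x y)).
by rewrite -ltrBrDl.
Qed.

(** Together with the lower bound below, this is how the measure of a set that
    meets each ray in an interval starting at the centre is computed: w j is the
    length on the j-th ray. *)
Lemma railway_measure_le (A : set (railway R k)) (w : nat -> R) :
  measurable A ->
  (forall j, (1 <= j <= k)%N -> (0 <= w j)%R) ->
  (forall j t, (1 <= j <= k)%N -> ray_trace A j t -> (t <= w j)%R) ->
  railway_measure R k A <= (k%:R^-1 * \sum_(j < k) w j.+1)%:E.
Proof.
move=> mA w0 Aw; rewrite /railway_measure EFinM -sumEFin.
apply: lee_wpmul2l; first by rewrite lee_fin invr_ge0.
apply: lee_sum => j _; have jk : (1 <= j.+1 <= k)%N by exact: ltn_ord.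
rewrite (@le_trans _ _ (lebesgue_measure `[0%R, w j.+1]))//.
  apply: le_measure; rewrite ?inE//; first exact: measurable_ray_trace.
  move=> t tA; have [] := tA; rewrite /= !in_itv /= => /andP[-> _] _.
  exact: (Aw _ _ jk tA).
rewrite lebesgue_measure_itv /= lte_fin; case: ifP => // _.
  by rewrite oppr0 adde0.
by rewrite lee_fin w0.
Qed.

Lemma railway_measure_ge (A : set (railway R k)) (w : nat -> R) :
  measurable A ->
  (forall j t, (1 <= j <= k)%N -> (0 < t < w j)%R -> ray_trace A j t) ->
  (k%:R^-1 * \sum_(j < k) w j.+1)%:E <= railway_measure R k A.
Proof.
move=> mA Aw; rewrite /railway_measure EFinM -sumEFin.
apply: lee_wpmul2l; first by rewrite lee_fin invr_ge0.
apply: lee_sum => j _; have jk : (1 <= j.+1 <= k)%N by exact: ltn_ord.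
rewrite (@le_trans _ _ (lebesgue_measure `]0%R, w j.+1[))//.
  rewrite lebesgue_measure_itv /= lte_fin; case: ltP => // w0.
  by rewrite oppr0 adde0.
apply: le_measure; rewrite ?inE//; first exact: measurable_ray_trace.
by move=> t /=; rewrite in_itv /=; exact: Aw.
Qed.

End railway_balls.

Section railway_finite.
Context {R : realType} {k : nat}.

Lemma railway_measure_fin : fin_num_fun (railway_measure R k).
Proof.
move=> A mA; rewrite ge0_fin_numE; last exact: measure_ge0.
apply: (le_lt_trans (@railway_measure_le R k A (fun=> 1%R) mA _ _)) => //.
- by move=> j t jk [+ _]; rewrite in_itv /= => /andP[].
- exact: ltry.
Qed.

HB.instance Definition _ := Measure_isFinite.Build _ _ _ (railway_measure R k)
  railway_measure_fin.

End railway_finite.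

Section skew_balls.
Context {R : realType} {k : nat}.

(** Solving a + r = u and r - a = v: a ball of radius r centred at distance
    a <= r from the centre, on the ray j0, reaches distance u on that ray and v
    on the others, where one has to travel through the centre.  For v = 0 the
    centre of the railway is excluded, which is what the bound - v < t says. *)
Lemma skew_ball (j0 : nat) (u v : R) : (1 <= j0 <= k)%N ->
  (0 <= v)%R -> (v <= u)%R -> (u <= 1)%R -> (0 < u)%R ->
  exists c r, (0 < r)%R /\
    forall (x : railway R k) j t, (1 <= j <= k)%N -> t \in `[0%R, 1%R] ->
      rval x = ray_point k j t ->
      (ball (c : railway R k) r x <->
       if j == j0 then (- v < t < u)%R else (t < v)%R).
Proof.
move=> j0k v0 vu u1 u0.
have a01 : ((u - v) / 2)%R \in `[0%R, 1%R].
  by rewrite in_itv /=; apply/andP; split; lra.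
exists (Railway (railway_set_ray_point j0k a01)), ((u + v) / 2)%R.
split; first by lra.
move=> x j t jk t01 xt; rewrite ball_railwayE /= xt.
case: eqVneq => [->|jj0].
  rewrite railway_dist_ray// ltr_norml.
  by split => /andP[? ?]; apply/andP; split; lra.
rewrite railway_dist_ne//; last by rewrite eq_sym.
by split => ?; lra.
Qed.

Lemma sum_one_else (V : nmodType) (j0 : nat) (u v : V) : (1 <= j0 <= k)%N ->
  (\sum_(j < k) (if j.+1 == j0 then u else v) = u + v *+ k.-1)%R.
Proof.
move=> /andP[j1 jk].
have jk' : (j0.-1 < k)%N by rewrite prednK.
rewrite (bigD1 (Ordinal jk'))//= prednK// eqxx; congr (_ + _)%R.
rewrite (eq_bigr (fun=> v)) => [|j jj0].
  by rewrite sumr_const cardC1 card_ord.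
rewrite ifN//; apply: contra jj0 => /eqP e.
by apply/eqP/val_inj => /=; rewrite -e.
Qed.

End skew_balls.

(** * Superlevel sets of the rearrangement *)

Section rearrangement_levels.
Context d (T : measurableType d) (R : realType) (P : probability T R).
Context (k : nat) (X : T -> R).
Hypothesis mX : measurable_fun setT X.
Implicit Types (x : railway R k) (r s : R).

Lemma upper_tail_nonincreasing r s : (r <= s)%R ->
  upper_tail P X s <= upper_tail P X r.
Proof.
move=> rs; apply: le_measure; rewrite ?inE; do ?exact: measurable_level.
by move=> w /=; exact: le_lt_trans.
Qed.

(** Right continuity of the upper tail. *)
Lemma upper_tail_le_of_gt r (t : \bar R) :
  (forall s, (r < s)%R -> upper_tail P X s <= t) -> upper_tail P X r <= t.
Proof.
move=> h; pose U n := [set w | (r + n.+1%:R^-1 < `|X w|)%R].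
have UE : [set w | (r < `|X w|)%R] = \bigcup_n U n.
  apply/seteqP; split => [w /= rX|w [n _]]; last first.
    by apply: lt_trans; rewrite ltrDl.
  have := near_infty_natSinv_lt (PosNum (etrans (subr_gt0 _ _) rX)).
  by move=> [n _ /(_ _ (leqnn n)) /=]; exists n => //; rewrite /U /= -ltrBrDl.
have mU n : measurable (U n) by exact: measurable_level.
have cU : (P \o U) @ \oo --> P (\bigcup_n U n).
  apply: nondecreasing_cvg_mu => //; first exact: bigcup_measurable.
  move=> m n mn; apply/subsetPset => w /=; apply: le_lt_trans.
  by rewrite lerD2l lef_pV2 ?posrE// ler_nat.
rewrite /upper_tail UE -(cvg_lim _ cU)//.
apply: lime_le; first by apply/cvg_ex; eexists; exact: cU.
by apply: nearW => n; apply: h; rewrite ltrDl.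
Qed.

Lemma rearrangement_ge0 x : 0 <= rearrangement P X x.
Proof. by apply: le_ereal_inf_tmp => _ [s [s0 _] <-]; rewrite lee_fin ltW. Qed.

(** A rearrangement is determined by its superlevel sets, which are the balls
    about the centre whose radii are the upper tails of X.  Right continuity of
    the tail is what makes both inequalities strict. *)
Lemma rearrangement_gt x r : (0 <= r)%R ->
  (r%:E < rearrangement P X x) =
  ((Normc.normc (rval x))%:E < upper_tail P X r).
Proof.
move=> r0; apply/idP/idP; apply: contraTT; rewrite -!leNgt => h.
  apply/lee_addgt0Pr => e e0; rewrite -EFinD.
  apply: ereal_inf_lbound; exists (r + e)%R => //; split.
    by rewrite ltr_wpDl.
  by apply: le_trans h; apply: upper_tail_nonincreasing; rewrite lerDl ltW.
apply: upper_tail_le_of_gt => s rs.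
have /ereal_inf_lt [_ [s' [s'0 hs'] <-]] : rearrangement P X x < s%:E.
  by apply: le_lt_trans h _; rewrite lte_fin.
rewrite lte_fin => s's; apply: le_trans hs'.
by apply: upper_tail_nonincreasing; exact: ltW.
Qed.

Lemma measurable_rearrangement :
  measurable_fun setT (rearrangement P X : railway R k -> \bar R).
Proof.
move=> mT; apply: (measurability _ (ErealGenOInfty.measurableE R)) => //.
move=> /= _ [_ [r ->] <-]; rewrite setTI.
have [r0|r0] := leP 0%R r.
  rewrite [X in measurable X](_ : _ =
      ball railway0 (fine (upper_tail P X r))).
    exact: measurable_railway_ball.
  rewrite ball_railway0; apply/seteqP; split => x /=;
    rewrite in_itv /= andbT rearrangement_gt// -lte_fin fineK//;
    exact: fin_num_measure (measurable_level _ mX).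
rewrite [X in measurable X](_ : _ = setT)//.
apply/seteqP; split => // x _ /=; rewrite in_itv /= andbT.
by apply: lt_le_trans (rearrangement_ge0 x); rewrite lte_fin.
Qed.

End rearrangement_levels.

(** * Averages of the rearrangement over balls *)

(** The Hardy-Littlewood inequality, used on each ray with its own event D j.
    By the layer cake formula on both sides, it is enough to compare, for each
    r, the lengths P(D j n {|X| > r}) with the traces of K n {X* > r}, and the
    trace on the j-th ray contains every 0 < t < P(D j) with
    t < P(|X| > r). *)
Lemma rearrangement_integral_ge d (T : measurableType d) (R : realType)
    (P : probability T R) (k : nat) (X : T -> R) (D : nat -> set T)
    (K : set (railway R k)) :
  measurable_fun setT X -> (forall j, measurable (D j)) -> measurable K ->
  (forall (x : railway R k) j t, (1 <= j <= k)%N -> rval x = ray_point k j t ->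
    (0 < t)%R -> t%:E < P (D j) -> K x) ->
  k%:R^-1%:E * \sum_(j < k) \int[P]_(w in D j.+1) `|X w|%:E <=
  \int[railway_measure R k]_(x in K) rearrangement P X x.
Proof.
move=> mX mD mK DK.
have mXE : measurable_fun setT (fun w => `|X w|%:E).
  by apply/measurable_EFinP; exact: measurableT_comp.
have mf := @measurable_rearrangement _ _ _ P k _ mX.
have f0 (x : railway R k) : 0 <= rearrangement P X x.
  exact: rearrangement_ge0.
pose tail j r := P (D j `&` [set w | r%:E < `|X w|%:E]).
have mtail j : measurable_fun setT (tail j).
  exact: measurable_tail_measure.
rewrite layer_cake//.
have -> : \sum_(j < k) \int[P]_(w in D j.+1) `|X w|%:E =
    \int[lebesgue_measure]_(r in `[0%R, +oo[) \sum_(j < k) tail j.+1 r.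
  rewrite ge0_integral_sum//; [|move=> j; exact: (measurable_funTS (mtail _))].
  by apply: eq_bigr => j _; rewrite layer_cake.
have msum : measurable_fun (`[0%R, +oo[%classic : set R)
    (fun r : R => \sum_(j < k) tail j.+1 r).
  by apply: emeasurable_sum => j; exact: (measurable_funTS (mtail _)).
have sum0 (r : R) : `[0%R, +oo[%classic r -> 0 <= \sum_(j < k) tail j.+1 r.
  by move=> _; exact: sume_ge0.
rewrite -ge0_integralZl ?lee_fin ?invr_ge0//.
apply: ge0_le_integral => //.
- by move=> r r0; rewrite mule_ge0 ?lee_fin ?invr_ge0// sum0.
- exact: measurable_funeM.
- by apply: measurable_funTS; exact: measurable_tail_measure.
move=> r /=; rewrite in_itv /= andbT => r0.
have mDr j : measurable (D j `&` [set w | r%:E < `|X w|%:E]).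
  by apply: measurableI => //; exact: measurable_level.
have tfin j : tail j r \is a fin_num by exact: fin_num_measure.
under eq_bigr do rewrite -(fineK (tfin _)).
rewrite sumEFin -EFinM.
apply: (railway_measure_ge (w := fun j => fine (tail j r))).
  apply: measurableI => //.
  by rewrite -[X in measurable X]setTI; exact: emeasurable_fun_o_infty.
move=> j t jk /andP[t0 ttail].
have {}ttail : t%:E < tail j r by rewrite -(fineK (tfin j)) lte_fin.
have tD : t%:E < P (D j).
  apply: lt_le_trans ttail _; apply: le_measure; rewrite ?inE;
    [exact: mDr|exact: mD|exact: subIsetl].
have tX : t%:E < upper_tail P X r.
  apply: lt_le_trans ttail _; apply: le_measure; rewrite ?inE;
    [exact: mDr|exact: measurable_level|exact: subIsetr].
have t01 : t \in `[0%R, 1%R].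
  rewrite in_itv /= (ltW t0) /= -lee_fin.
  exact: le_trans (ltW tD) (probability_le1 _ _).
pose x : railway R k := Railway (railway_set_ray_point jk t01).
have xt : rval x = ray_point k j t by [].
apply/(ray_traceE _ t01 xt); split; first exact: (DK x j t).
by rewrite /= rearrangement_gt// xt normc_ray_point ger0_norm// ltW.
Qed.

(** The ball reaching distance P(C) on the ray of x and P(B) on the other rays
    contains x, and the average of the rearrangement over it is at least s. *)
Lemma railway_maximal_ge d (T : measurableType d) (R : realType)
    (P : probability T R) (k : nat) (X : T -> R) (B C : set T) (s : R)
    (x : railway R k) (j0 : nat) (t : R) :
  measurable_fun setT X -> measurable B -> measurable C -> B `<=` C ->
  s%:E * (P C + k.-1%:R%:E * P B) <=
  \int[P]_(w in C) `|X w|%:E + k.-1%:R%:E * \int[P]_(w in B) `|X w|%:E ->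
  (1 <= j0 <= k)%N -> rval x = ray_point k j0 t -> (0 < t)%R -> t%:E < P C ->
  s%:E <= railway_maximal (rearrangement P X) x.
Proof.
move=> mX mB mC BC sCB j0k xt t0 tC.
have PCfin : P C \is a fin_num by exact: fin_num_measure.
have PBfin : P B \is a fin_num by exact: fin_num_measure.
pose u := fine (P C); pose v := fine (P B).
have uE : P C = u%:E by rewrite fineK.
have vE : P B = v%:E by rewrite fineK.
have k0 : (0 < k)%N by case/andP: j0k => /leq_trans; apply.
have kV0 : (0 < (k%:R : R)^-1)%R by rewrite invr_gt0 ltr0n.
have u1 : (u <= 1)%R by rewrite -lee_fin -uE probability_le1.
have v0 : (0 <= v)%R by rewrite -lee_fin -vE.
have vu : (v <= u)%R by rewrite -lee_fin -uE -vE le_measure ?inE.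
have tu : (t < u)%R by rewrite -lte_fin -uE.
have u0 : (0 < u)%R by exact: lt_trans tu.
have [c [r [r0 cr]]] := skew_ball j0k v0 vu u1 u0.
pose D j := if j == j0 then C else B.
have mD j : measurable (D j) by rewrite /D; case: ifP.
have DE j : P (D j) = (if j == j0 then u else v)%:E by rewrite /D; case: ifP.
have mK := measurable_railway_ball c r.
have K_D (y : railway R k) j t' : (1 <= j <= k)%N ->
    rval y = ray_point k j t' -> (0 < t')%R -> t'%:E < P (D j) -> ball c r y.
  move=> jk yt' t'0 t'D; apply/(cr y j t' jk _ yt').
    rewrite in_itv /= (ltW t'0) /= -lee_fin.
    exact: le_trans (ltW t'D) (probability_le1 _ _).
  move: t'D; rewrite DE lte_fin; case: ifP => // _ ->; rewrite andbT.
  by apply: le_lt_trans t'0; rewrite oppr_le0.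
have intK := rearrangement_integral_ge mX mD mK K_D.
have leK : railway_measure R k (ball c r) <= (k%:R^-1 * (u + v *+ k.-1))%:E.
  rewrite -(sum_one_else (k := k) u v j0k).
  apply: (railway_measure_le (w := fun j => if j == j0 then u else v)) => //.
    by move=> j _; case: ifP => // _; exact: ltW.
  move=> j t' jk Kt'; have [t'01 [y Ky yt']] := Kt'.
  move: Ky => /(cr y j t' jk t'01 yt').
  by case: ifP => _; [case/andP=> _ /ltW|move/ltW].
have geK : (k%:R^-1 * (u + v *+ k.-1))%:E <= railway_measure R k (ball c r).
  rewrite -(sum_one_else (k := k) u v j0k).
  apply: (railway_measure_ge (w := fun j => if j == j0 then u else v)) => //.
  move=> j t' jk /andP[t'0 t'w].
  have t'01 : t' \in `[0%R, 1%R].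
    rewrite in_itv /= (ltW t'0) /= (le_trans (ltW t'w))//.
    by case: ifP => // _; exact: le_trans vu u1.
  apply/(ray_traceE _ t'01
    (x := Railway (railway_set_ray_point jk t'01))) => //.
  by apply: (K_D _ j t') => //; rewrite DE lte_fin.
have measK : railway_measure R k (ball c r) = (k%:R^-1 * (u + v *+ k.-1))%:E.
  by apply/eqP; rewrite eq_le leK geK.
apply: (@le_trans _ _ ((railway_measure R k (ball c r))^-1 *
   \int[railway_measure R k]_(y in ball c r)
     `|rearrangement P X y|)); last first.
  apply: ereal_sup_ubound; exists (ball c r) => //; split; last by exists c, r.
  by apply: (K_D x j0 t) => //; rewrite /D eqxx.
under eq_integral do rewrite gee0_abs ?rearrangement_ge0//.
have m0 : (0 < k%:R^-1 * (u + v *+ k.-1))%R.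
  by rewrite mulr_gt0// ltr_wpDr// mulrn_wge0.
rewrite measK inver gt_eqF// lee_pdivlMl//.
apply: le_trans intK.
rewrite (eq_bigr (fun j : 'I_k => if j.+1 == j0 then \int[P]_(w in C) `|X w|%:E
   else \int[P]_(w in B) `|X w|%:E)); last by move=> j _; rewrite /D; case: ifP.
rewrite (sum_one_else (k := k) _ _ j0k) EFinM -muleA.
apply: lee_wpmul2l; first by rewrite lee_fin ltW.
have uvE : P C + k.-1%:R%:E * P B = (u + v *+ k.-1)%:E.
  by rewrite uE vE EFinD -[(v *+ _)%R]mulr_natl EFinM.
by move: sCB; rewrite uvE muleC mule_natl.
Qed.

(** * The maximal inequality on the railway *)

(** The ball built for a point of some ray reaches the other rays up to
    P(B) only, so it misses the centre when P(B) = 0.  This is the exceptional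
    null set. *)
Lemma railway_center_negligible (R : realType) (k : nat) :
  (railway_measure R k).-negligible [set x | Normc.normc (rval x) = 0%R].
Proof.
set A := [set x | _].
have mA : measurable A.
  rewrite (_ : A = \bigcap_n ball (@railway0 R k) n.+1%:R^-1).
    by apply: bigcapT_measurable => n; exact: measurable_railway_ball.
  apply/seteqP; split => x /= xA.
    by move=> n _; rewrite ball_railway0 /= xA.
  apply/eqP; rewrite eq_le normc_ge0 andbT leNgt; apply/negP => x0.
  have [n _ /(_ _ (leqnn n)) /= nx] := near_infty_natSinv_lt (PosNum x0).
  by have := xA n Logic.I; rewrite ball_railway0 /= ltNge ltW.
exists A; split => //; apply/eqP; rewrite eq_le measure_ge0 andbT.
apply: (le_trans (railway_measure_le (w := fun=> 0%R) mA _ _)) => //.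
  move=> j t jk [_ [y yA yt]].
  by move: yA; rewrite /A /= yt normc_ray_point => /normr0_eq0 ->.
by rewrite big1// mulr0.
Qed.

Lemma railway_maximal_ge0 (R : realType) (k : nat)
    (f : railway R k -> \bar R) (x : railway R k) :
  0 <= railway_maximal f x.
Proof.
apply: (@le_trans _ _ ((railway_measure R k (ball x 1))^-1 *
   \int[railway_measure R k]_(y in ball x 1) `|f y|)).
  by rewrite mule_ge0 ?inve_ge0 ?measure_ge0 ?integral_ge0.
apply: ereal_sup_ubound; exists (ball x 1%R) => //.
split; last by exists x, 1%R.
exact: ballxx.
Qed.

Theorem theorem1p3 (R : realType) (d : measure_display) (T : measurableType d)
    (P : probability T R) (P_nonatomic : nonatomic P)
    (k n : nat) (k_ge1 : (1 <= k)%N) (n_ge1 : (1 <= n)%N)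
    (xi : T -> R) (xi_integrable : P.-integrable setT (EFin \o xi))
    (G : 'I_n -> 'I_k -> set (set T))
    (G_sub : forall i j, is_sub_sigma_algebra (G i j))
    (G_incr : forall (j : 'I_k) (i1 i2 : 'I_n), (i1 <= i2)%N ->
      G i1 j `<=` G i2 j)
    (E : 'I_n -> 'I_k -> T -> R)
    (E_cond_exp : forall i j, is_cond_exp P (G i j) xi (E i j)) :
  {ae railway_measure R k, forall x : railway R k,
    rearrangement P (max_abs E) x <= railway_maximal (rearrangement P xi) x}.
Proof.
have mxi := integrable_measurable xi_integrable.
have mE i j : measurable_fun setT (E i j).
  by have [_ /integrable_measurable] := E_cond_exp i j.
have mM : measurable_fun setT (max_abs E).
  apply: measurable_bigmaxr => i; apply: measurable_bigmaxr => j.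
  exact: measurableT_comp.
apply: (negligibleS _ (railway_center_negligible R k)) => x /= nle.
apply: contrapT => x0; apply: nle.
have [j0 j0k [t t01 xt]] : exists2 j0, (1 <= j0 <= k)%N & ray k j0 (rval x).
  have [x_0|[j jk xj]] := railwayP x; last by exists j.
  by case: x0; rewrite x_0; exact: Normc.normc0.
have normx : Normc.normc (rval x) = t.
  rewrite -xt normc_ray_point ger0_norm//.
  by move: t01; rewrite /= in_itv => /andP[].
have t0 : (0 < t)%R.
  by rewrite lt_neqAle -normx normc_ge0 andbT eq_sym; exact/eqP.
have := railway_maximal_ge0 (rearrangement P xi) x.
case maxE : (railway_maximal _ x) => [a| |]//; last by move=> _; exact: leey.
(* The level is s = a + e > 0, just above the value a of the maximal function
   at x: if the rearrangement of M exceeded it, a would be at least s. *)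
rewrite lee_fin => a0; apply/lee_addgt0Pr => e e0; rewrite leNgt -EFinD.
have ae0 : (0 < a + e)%R by rewrite ltr_wpDl.
rewrite rearrangement_gt ?ltW// normx; apply/negP => tM.
pose B := [set w | (a + e < `|xi w|)%R].
pose A j := [set w | exists i, (a + e < `|E i j w|)%R].
pose C := B `|` \bigcup_j A j.
have mB : measurable B by exact: measurable_level.
have mC : measurable C.
  apply: measurableU => //; apply: fin_bigcup_measurable => // j _.
  by apply: measurable_exists_level => i; exact: mE.
have tC : t%:E < P C.
  apply: lt_le_trans tM _; apply: le_measure; rewrite ?inE//.
    exact: measurable_level.
  move=> w /(max_abs_gt (ltW ae0)) [j [i jiw]].
  by right; exists j => //; exists i.
have := maximal_level_integral xi_integrable G_sub G_incr E_cond_exp (ltW ae0).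
move=> /(railway_maximal_ge mxi mB mC (@subsetUl _ _ _)).
move=> /(_ x j0 t j0k (esym xt) t0 tC).
by rewrite maxE lee_fin leNgt ltrDl e0.
Qed.
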